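(* Let $X\subset\mathbb{R}^n$ be a closed and convex set, and let $f\in\mathbb{R}[x]$, $x=(x_1,\dots,x_n)$, be a polynomial such that $f(x)\ge m$ for $x\in X$ and some $m>0$. Then there exists $N_0\in\mathbb{R}$ such that for any $N\ge N_0$ the function $\varPhi_N(x)=e^{e^{N|x|^2}}f(x)$ is strongly convex on $X$.
   Context: $|\cdot|$ is the Euclidean norm on $\mathbb{R}^n$. A function $\varphi$ is strongly convex on a convex set $X$ if for some $\mu>0$ the function $\varphi(x)-\frac{\mu}{2}|x|^2$ is convex on $X$. *)

(* Defs.v *)
From mathcomp Require Import all_boot all_order all_algebra.
From mathcomp Require Import all_classical all_reals all_analysis.
(* Not imported: the notations of mpoly clash with those of MathComp-Analysis. *)
From mathcomp Require mpoly.

Set Implicit Arguments.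
Unset Strict Implicit.
Unset Printing Implicit Defensive.

Import Order.TTheory GRing.Theory Num.Theory.
Import numFieldNormedType.Exports.

Local Open Scope classical_set_scope.
Local Open Scope ring_scope.

(* The library norm on row vectors is the sup norm; the topologies agree. *)
Definition enorm (R : realType) (n : nat) (x : 'rV[R]_n) : R :=
  Num.sqrt (\sum_(i < n) x 0 i ^+ 2).

Definition peval (R : realType) (n : nat) (f : mpoly.mpoly n R)
    (x : 'rV[R]_n) : R :=
  mpoly.meval (fun i => x 0 i) f.

Definition strongly_convex (R : realType) (n : nat) (X : set 'rV[R]_n)
    (phi : 'rV[R]_n -> R) : Prop :=
  exists2 mu : R, 0 < mu &
    convex_function X (fun x => phi x - mu / 2 * enorm x ^+ 2).

Definition Phi (R : realType) (n : nat) (f : mpoly.mpoly n R) (N : R)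
    (x : 'rV[R]_n) : R :=
  expR (expR (N * enorm x ^+ 2)) * peval f x.

(* Main.v *)
Require Import Defs.
From mathcomp Require Import all_boot all_order all_algebra.
From mathcomp Require Import all_classical all_reals all_analysis.
From mathcomp Require mpoly.
From mathcomp Require Import ring lra.
Import -(notations) mpoly.

Set Implicit Arguments.
Unset Strict Implicit.
Unset Printing Implicit Defensive.

Import Order.TTheory GRing.Theory Num.Theory.
Import numFieldNormedType.Exports.

Local Open Scope classical_set_scope.
Local Open Scope ring_scope.

(** Convexity is tested on segments. On the line z = x + s v write r = |z|^2,
    E = exp (N r), u = |v|, and let p, p1, p2 be the value of f and its first
    two derivatives in s, so that r' = 2 <z, v> and r'' = 2 u^2. With b = N r',

      (exp E p)'' = exp E ((E b)^2 p + 2 (E b) p1 + p2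
                           + E b^2 p + 2 N E u^2 p).

    On X one has p >= m > 0. The derivatives of f are polynomials, so a single
    polynomial h bounds them: |p1| <= h u and |p2| <= h u^2
    ([mdirderiv_bound]). Completing the square in E b, the first three terms are
    at least - (h^2 / m + h) u^2 ([quadratic_form_ge]); the fourth is
    nonnegative; the fifth is at least 2 m N E u^2. Everything thus reduces to
    h^2 / m + h + 1 <= 2 m N exp (N |z|^2) at every z: then the bracket is at
    least u^2, and so is the whole expression since exp E >= 1
    ([expexpM2_ge]). The left side is a polynomial, hence bounded by some
    C exp (k |z|^2) ([peval_exp_growth]), and N >= k with 2 m N >= C suffices.
    With exp (N |x|^2) f in place of the double exponential, the term playing
    the part of the fifth would only be bounded below by 2 m N u^2, which does
    not absorb (h^2 / m + h) u^2 when X is unbounded: the inner exponential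
    supplies the growing factor E. The modulus of strong
    convexity obtained is 1 for all these N. *)

(** * Polynomials in several variables *)

(** Reduces a property stable under sums and products to constants and
    variables; the chain rule and the growth bound below are proved this way. *)
Lemma mpoly_gen_ind (R : comNzRingType) (n : nat) (P : mpoly n R -> Prop) :
    (forall c, P (mpolyC n c)) -> (forall i, P (mpolyX R (mnm1 i))) ->
    (forall p q, P p -> P q -> P (p + q)) ->
    (forall p q, P p -> P q -> P (p * q)) ->
  forall p, P p.
Proof.
move=> PC PX PD PM p.
have P1 : P 1 by exact: (PC 1).
elim/mpolyind: p => [|c a p _ _ Pp]; first by rewrite -(mpolyC0 n R); exact: PC.
apply: PD => //; rewrite -mul_mpolyC; apply: (PM) => //.
rewrite mpolyXE_id; apply: big_ind => // i _.
elim: (a i) => [|k IH]; first by rewrite expr0.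
by rewrite exprS; apply: PM.
Qed.

(** Being again a polynomial, it can be iterated: [mdirderiv v (mdirderiv v p)]
    is the second derivative along v. *)
Definition mdirderiv (R : realType) (n : nat) (v : 'rV[R]_n) (p : mpoly n R) :
  mpoly n R := \sum_(i < n) v 0 i *: mderiv i p.

Section PolynomialEvaluation.
Variables (R : realType) (n : nat).
Implicit Types (p q f : mpoly n R) (x v z : 'rV[R]_n).

Lemma peval0 z : peval 0 z = 0 :> R.
Proof. exact: meval0. Qed.

Lemma pevalC c z : peval (mpolyC n c) z = c :> R.
Proof. exact: mevalC. Qed.

Lemma pevalX i z : peval (mpolyX R (mnm1 i)) z = z 0 i.
Proof. exact: mevalXU. Qed.

Lemma pevalD p q z : peval (p + q) z = peval p z + peval q z.
Proof. exact: mevalD. Qed.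

Lemma pevalM p q z : peval (p * q) z = peval p z * peval q z.
Proof. exact: mevalM. Qed.

Lemma pevalZ c p z : peval (c *: p) z = c * peval p z.
Proof. exact: mevalZ. Qed.

Lemma peval1 z : peval 1 z = 1.
Proof. exact: meval1. Qed.

Lemma pevalXn p k z : peval (p ^+ k) z = peval p z ^+ k.
Proof. exact: rmorphXn. Qed.

Lemma peval_sum (I : Type) (r : seq I) (F : I -> mpoly n R) z :
  peval (\sum_(i <- r) F i) z = \sum_(i <- r) peval (F i) z.
Proof. exact: raddf_sum. Qed.

Definition pevalE := (pevalC, pevalX, pevalD, pevalM, pevalZ, peval1, pevalXn,
  peval_sum).

Lemma mdirderivC v c : mdirderiv v (mpolyC n c) = 0.
Proof. by apply: big1 => i _; rewrite mderivC scaler0. Qed.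

Lemma mdirderivX v i : mdirderiv v (mpolyX R (mnm1 i)) = mpolyC n (v 0 i).
Proof.
rewrite /mdirderiv (bigD1 i)//= big1 ?addr0 => [|j ji].
  rewrite mderivX mnm1E eqxx scale1r.
  have -> : mnm_sub (mnm1 i) (mnm1 i) = mnm0.
    by apply/mnmP => j; rewrite mnmBE mnm0E subnn.
  by rewrite mpolyX0 -mul_mpolyC mulr1.
by rewrite mderivX mnm1E eq_sym (negbTE ji) scale0r scaler0.
Qed.

Lemma mdirderivD v p q : mdirderiv v (p + q) = mdirderiv v p + mdirderiv v q.
Proof.
by rewrite -big_split; apply: eq_bigr => i _; rewrite mderivD scalerDr.
Qed.

Lemma mdirderivM v p q :
  mdirderiv v (p * q) = mdirderiv v p * q + p * mdirderiv v q.
Proof.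
rewrite mulr_suml mulr_sumr -big_split; apply: eq_bigr => i _ /=.
by rewrite mderivM scalerDr scalerAl scalerAr.
Qed.

Lemma mdirderivZ v c p : mdirderiv v (c *: p) = c *: mdirderiv v p.
Proof.
rewrite scaler_sumr; apply: eq_bigr => i _.
by rewrite mderivZ !scalerA mulrC.
Qed.

Lemma mdirderiv_sum (I : Type) v (r : seq I) (F : I -> mpoly n R) :
  mdirderiv v (\sum_(i <- r) F i) = \sum_(i <- r) mdirderiv v (F i).
Proof.
elim: r => [|i r IH]; last by rewrite !big_cons mdirderivD IH.
by rewrite !big_nil -{1}(mpolyC0 n R) mdirderivC.
Qed.

Lemma is_derive_peval_line p x v (s : R) :
  is_derive s 1 (fun t => peval p (x + t *: v))
    (peval (mdirderiv v p) (x + s *: v)).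
Proof.
elim/mpoly_gen_ind: p => [c|i|p q dp dq|p q dp dq].
- rewrite mdirderivC peval0.
  rewrite [X in is_derive _ _ X _](_ : _ = cst c); last first.
    by apply/funext => t; rewrite pevalC.
  exact: is_derive_cst.
- rewrite mdirderivX pevalC.
  rewrite [X in is_derive _ _ X _](_ : _ = cst (x 0 i) + v 0 i \*: id).
    by apply: is_derive_eq; rewrite add0r /GRing.scale/= mulr1.
  by apply/funext => t; rewrite pevalX !mxE/= mulrC.
- rewrite mdirderivD pevalD.
  rewrite [X in is_derive _ _ X _](_ : _ =
    (fun t => peval p (x + t *: v)) + (fun t => peval q (x + t *: v))).
    exact: is_deriveD.
  by apply/funext => t; rewrite pevalD.
- rewrite mdirderivM pevalD !pevalM.
  rewrite [X in is_derive _ _ X _](_ : _ =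
    (fun t => peval p (x + t *: v)) * (fun t => peval q (x + t *: v))).
    have := is_deriveM dp dq; move=> /is_derive_eq; apply.
    by rewrite /GRing.scale/= addrC; congr (_ + _); rewrite mulrC.
  by apply/funext => t; rewrite pevalM.
Qed.

End PolynomialEvaluation.

(** * The squared Euclidean norm *)

Section SquaredNorm.
Variables (R : realType) (n : nat).
Implicit Types (x v z : 'rV[R]_n).

(** Having |z|^2 as a polynomial makes its derivatives along a line instances
    of [is_derive_peval_line]. *)
Definition sqnorm_poly : mpoly n R :=
  \sum_(i < n) mpolyX R (mnm1 i) ^+ 2.

Lemma enorm_ge0 z : 0 <= enorm z.
Proof. exact: sqrtr_ge0. Qed.

Lemma enorm_sqr z : enorm z ^+ 2 = \sum_(i < n) z 0 i ^+ 2.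
Proof. by rewrite sqr_sqrtr// sumr_ge0// => i _; exact: sqr_ge0. Qed.

Lemma peval_sqnorm_poly z : peval sqnorm_poly z = enorm z ^+ 2.
Proof. by rewrite enorm_sqr pevalE; apply: eq_bigr => i _; rewrite !pevalE. Qed.

Lemma sqr_coord_le_enorm z i : z 0 i ^+ 2 <= enorm z ^+ 2.
Proof.
rewrite enorm_sqr (bigD1 i)//= lerDl sumr_ge0// => j _; exact: sqr_ge0.
Qed.

Lemma coord_le_enorm z i : `|z 0 i| <= enorm z.
Proof.
rewrite -(@ler_pXn2r _ 2) ?nnegrE ?normr_ge0 ?enorm_ge0//.
by rewrite real_normK ?num_real// sqr_coord_le_enorm.
Qed.

Lemma mdirderiv2_sqnorm_poly v :
  mdirderiv v (mdirderiv v sqnorm_poly) = mpolyC n (2 * enorm v ^+ 2).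
Proof.
rewrite [mdirderiv v sqnorm_poly]mdirderiv_sum mdirderiv_sum enorm_sqr.
rewrite mulr_sumr raddf_sum; apply: eq_bigr => i _ /=.
rewrite expr2 mdirderivM mdirderivX.
rewrite mdirderivD !mdirderivM mdirderivC !mdirderivX mul0r mulr0 add0r addr0.
by rewrite -mpolyCM -mpolyCD expr2 mulr2n mulrDl mul1r.
Qed.

End SquaredNorm.
Arguments sqnorm_poly {R n}.

(** * Bounds on polynomials and their derivatives *)

Section Growth.
Variables (R : realType) (n : nat).
Implicit Types (p q f : mpoly n R) (x v z : 'rV[R]_n).

Lemma norm_le_1Dsqr (a : R) : `|a| <= 1 + a ^+ 2.
Proof. by rewrite -(real_normK (num_real a)); have := normr_ge0 a; nra. Qed.

(** An exponential majorant in place of a power of 1 + |z|^2: exponents add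
    under products, so no degrees are tracked, and the bound is directly
    comparable to exp (N |z|^2). For a variable, it is
    |z_i| <= 1 + |z|^2 <= exp (|z|^2). *)
Lemma peval_exp_growth p :
  exists C k : R, [/\ 0 <= C, 0 <= k &
    forall z, `|peval p z| <= C * expR (k * enorm z ^+ 2)].
Proof.
elim/mpoly_gen_ind: p => [c|i|p q [C [k [C0 k0 Hp]]] [D [l [D0 l0 Hq]]]
  |p q [C [k [C0 k0 Hp]]] [D [l [D0 l0 Hq]]]].
- exists `|c|, 0; split => // z.
  by rewrite pevalC mul0r expR0 mulr1.
- exists 1, 1; split => // z.
  rewrite pevalX !mul1r.
  apply: le_trans (expR_ge1Dx _).
  by apply: le_trans (norm_le_1Dsqr _) _; rewrite lerD2l sqr_coord_le_enorm.
- exists (C + D), (k + l); split; rewrite ?addr_ge0// => z.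
  rewrite pevalD (le_trans (ler_normD _ _))// mulrDl lerD//.
    apply: le_trans (Hp z) _; rewrite ler_wpM2l// ler_expR ler_wpM2r ?sqr_ge0//.
    by rewrite lerDl.
  apply: le_trans (Hq z) _; rewrite ler_wpM2l// ler_expR ler_wpM2r ?sqr_ge0//.
  by rewrite lerDr.
- exists (C * D), (k + l); split; rewrite ?mulr_ge0 ?addr_ge0// => z.
  by rewrite pevalM normrM mulrDl expRD mulrACA ler_pM.
Qed.

(** The bound is the sum over all partial derivatives g of order 1 and 2 of
    1 + g^2, which dominates |g| and, unlike |g|, is a polynomial: the growth
    estimate applies to it. *)
Lemma mdirderiv_bound f :
  exists h : mpoly n R, forall z v,
    [/\ 0 <= peval h z,
        `|peval (mdirderiv v f) z| <= peval h z * enorm v &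
        `|peval (mdirderiv v (mdirderiv v f)) z| <= peval h z * enorm v ^+ 2].
Proof.
pose h1 : mpoly n R := \sum_(i < n) (1 + mderiv i f ^+ 2).
pose h2 : mpoly n R :=
  \sum_(i < n) \sum_(j < n) (1 + mderiv j (mderiv i f) ^+ 2).
have h1_ge0 z : 0 <= peval h1 z.
  rewrite pevalE sumr_ge0// => i _.
  by rewrite !pevalE addr_ge0 ?sqr_ge0.
have h2_ge0 z : 0 <= peval h2 z.
  rewrite pevalE sumr_ge0// => i _; rewrite pevalE sumr_ge0// => j _.
  by rewrite !pevalE addr_ge0 ?sqr_ge0.
exists (h1 + h2) => z v; rewrite pevalD; split; first by rewrite addr_ge0.
- apply: (@le_trans _ _ (peval h1 z * enorm v)); last first.
    by rewrite ler_wpM2r ?enorm_ge0// lerDl.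
  rewrite pevalE (le_trans (ler_norm_sum _ _ _))//.
  rewrite pevalE mulr_suml ler_sum// => i _.
  rewrite !pevalE normrM mulrC ler_pM//; last exact: coord_le_enorm.
  exact: norm_le_1Dsqr.
- apply: (@le_trans _ _ (peval h2 z * enorm v ^+ 2)); last first.
    by rewrite ler_wpM2r ?sqr_ge0// lerDr.
  rewrite mdirderiv_sum pevalE (le_trans (ler_norm_sum _ _ _))//.
  rewrite pevalE mulr_suml ler_sum// => i _.
  rewrite mdirderivZ pevalE pevalE mulr_sumr (le_trans (ler_norm_sum _ _ _))//.
  rewrite pevalE mulr_suml ler_sum// => j _.
  rewrite !pevalE mulrA normrM mulrC ler_pM//; first exact: norm_le_1Dsqr.
  by rewrite normrM expr2 ler_pM// coord_le_enorm.
Qed.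

End Growth.

(** * The second derivative of exp (exp (N q)) p in one variable *)

Section OneVariable.
Variable R : realType.

(** The weights are those of the convex combination t x + (1 - t) y, whose
    parameter on the segment from x to y is 1 - t. *)
Lemma second_derive_ge0_conv01 (g g1 g2 : R -> R)
    (dg : forall s : R, is_derive s 1 g (g1 s))
    (dg1 : forall s : R, is_derive s 1 g1 (g2 s))
    (g2_ge0 : forall s, 0 < s < 1 -> 0 <= g2 s) (t : {i01 R}) :
  g (1 - t%:num) <= t%:num * g 0 + (1 - t%:num) * g 1.
Proof.
have Dg : 'D_1 g = g1 by apply/funext => s; have [] := dg s.
have gcont s : {for s, continuous g}.
  exact/differentiable_continuous/derivable1_diffP.
have := @second_derivative_convex R g 0 1 _ _ _ _ _ t ler01.
rewrite !convRE mulr0 add0r mulr1 => -> //.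
- by move=> s s01; rewrite Dg derive_val; exact: g2_ge0.
- exact/cvg_at_left_filter/gcont.
- exact/cvg_at_right_filter/gcont.
- by move=> s _; rewrite Dg.
Qed.

(** With q the squared norm along a segment and c = mu / 2, this is the
    second-derivative criterion for strong convexity of modulus mu. *)
Lemma second_derive_ge_conv01 (c : R) (g g1 g2 q q1 q2 : R -> R)
    (dg : forall s : R, is_derive s 1 g (g1 s))
    (dg1 : forall s : R, is_derive s 1 g1 (g2 s))
    (dq : forall s : R, is_derive s 1 q (q1 s))
    (dq1 : forall s : R, is_derive s 1 q1 (q2 s))
    (q2_le_g2 : forall s, 0 < s < 1 -> c * q2 s <= g2 s) (t : {i01 R}) :
  let F s := g s - c * q s in
  F (1 - t%:num) <= t%:num * F 0 + (1 - t%:num) * F 1.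
Proof.
apply: (@second_derive_ge0_conv01 (fun s => g s - c * q s)
  (fun s => g1 s - c * q1 s) (fun s => g2 s - c * q2 s)) => s s01.
by rewrite subr_ge0 q2_le_g2.
Qed.

(** [expexpM], [expexpM1] and [expexpM2] are the values at a point of
    exp (exp (N q)) p and of its first two derivatives, where p1, p2, q1, q2
    stand for the values of the derivatives of p and q. Stating them on numbers
    separates differentiation from the estimate. *)
Definition expexpM (N p q : R) : R := expR (expR (N * q)) * p.

Definition expexpM1 (N p p1 q q1 : R) : R :=
  let E := expR (N * q) in expR E * (E * (N * q1) * p + p1).

Definition expexpM2 (N p p1 p2 q q1 q2 : R) : R :=
  let E := expR (N * q) in
  let b := N * q1 in
  expR E * ((E * b) ^+ 2 * p + 2 * (E * b) * p1 + p2
           + E * b ^+ 2 * p + E * (N * q2) * p).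

Lemma is_derive_expR_scaled (N s : R) (q q1 : R -> R) :
    is_derive s 1 q (q1 s) ->
  is_derive s 1 (fun t => expR (N * q t)) (expR (N * q s) * (N * q1 s)).
Proof.
by move=> dq; apply: (@is_derive1_comp R expR (fun t => N * q t)).
Qed.

Lemma is_derive_expexp (N s : R) (q q1 : R -> R) :
    is_derive s 1 q (q1 s) ->
  is_derive s 1 (fun t => expR (expR (N * q t)))
    (expR (expR (N * q s)) * (expR (N * q s) * (N * q1 s))).
Proof.
move=> dq; have dE := is_derive_expR_scaled N dq.
by apply: (@is_derive1_comp R expR (fun t => expR (N * q t))).
Qed.

Lemma is_derive_expexpM (N s : R) (p p1 q q1 : R -> R) :
    is_derive s 1 p (p1 s) -> is_derive s 1 q (q1 s) ->
  is_derive s 1 (fun t => expexpM N (p t) (q t))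
    (expexpM1 N (p s) (p1 s) (q s) (q1 s)).
Proof.
move=> dp dq; have := is_deriveM (is_derive_expexp N dq) dp.
by move=> /is_derive_eq; apply; rewrite /expexpM1 /GRing.scale/=; ring.
Qed.

Lemma is_derive_expexpM1 (N s : R) (p p1 p2 q q1 q2 : R -> R) :
    is_derive s 1 p (p1 s) -> is_derive s 1 p1 (p2 s) ->
    is_derive s 1 q (q1 s) -> is_derive s 1 q1 (q2 s) ->
  is_derive s 1 (fun t => expexpM1 N (p t) (p1 t) (q t) (q1 t))
    (expexpM2 N (p s) (p1 s) (p2 s) (q s) (q1 s) (q2 s)).
Proof.
move=> dp dp1 dq dq1.
have dE := is_derive_expR_scaled N dq.
have dNq1 : is_derive s 1 (fun t => N * q1 t) (N * q2 s) by exact: is_deriveZ.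
have dB := is_deriveD (is_deriveM (is_deriveM dE dNq1) dp) dp1.
have := is_deriveM (is_derive_expexp N dq) dB.
move=> /is_derive_eq; apply.
by rewrite /expexpM2 /GRing.scale/= !fctE/=; ring.
Qed.

(** Completing the square: m a^2 + 2 a p1 >= - p1^2 / m >= - h^2 u^2 / m. *)
Lemma quadratic_form_ge (m p p1 p2 h u a : R) :
    0 < m -> m <= p -> `|p1| <= h * u -> `|p2| <= h * u ^+ 2 ->
  - (h ^+ 2 / m + h) * u ^+ 2 <= a ^+ 2 * p + 2 * a * p1 + p2.
Proof.
move=> m0 mp; rewrite !ler_norml => /andP[p1l p1u] /andP[p2l _].
have p1sq : p1 ^+ 2 <= h ^+ 2 * u ^+ 2 by nra.
have : 0 <= m * (a + p1 / m) ^+ 2 by rewrite mulr_ge0 ?sqr_ge0 ?ltW.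
have -> : m * (a + p1 / m) ^+ 2 = a ^+ 2 * m + 2 * a * p1 + p1 ^+ 2 / m.
  by field; rewrite gt_eqF.
have : p1 ^+ 2 / m <= h ^+ 2 * u ^+ 2 / m by rewrite ler_pM2r ?invr_gt0.
have : a ^+ 2 * m <= a ^+ 2 * p by rewrite ler_wpM2l ?sqr_ge0.
have -> : - (h ^+ 2 / m + h) * u ^+ 2 = - (h ^+ 2 * u ^+ 2 / m) - h * u ^+ 2.
  by ring.
lra.
Qed.

(** The derivatives p1 and p2 cost at most (h^2 / m + h) u^2, and the term
    E N q'' p with q'' = 2 u^2 repays that and leaves u^2, whatever q1 is. *)
Lemma expexpM2_ge (N m p p1 p2 q q1 h u : R) :
    0 <= N -> 0 < m -> m <= p -> `|p1| <= h * u -> `|p2| <= h * u ^+ 2 ->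
    h ^+ 2 / m + h + 1 <= 2 * m * N * expR (N * q) ->
  u ^+ 2 <= expexpM2 N p p1 p2 q q1 (2 * u ^+ 2).
Proof.
move=> N_ge0 m_gt0 mp p1u p2u; rewrite /expexpM2.
set E := expR (N * q); set b := N * q1 => absorb.
have := quadratic_form_ge (E * b) m_gt0 mp p1u p2u.
set B := (E * b) ^+ 2 * _ + _ + _ => B_ge.
have E_ge0 : 0 <= E by exact: expR_ge0.
have u_ge0 : 0 <= u ^+ 2 by exact: sqr_ge0.
have p_ge0 : 0 <= p by exact: le_trans (ltW m_gt0) mp.
have t1 : 0 <= E * b ^+ 2 * p.
  by apply: mulr_ge0 => //; apply: mulr_ge0 => //; exact: sqr_ge0.
have t2 : 2 * m * N * E * u ^+ 2 <= E * (N * (2 * u ^+ 2)) * p.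
  rewrite [leLHS](_ : _ = E * (N * (2 * u ^+ 2)) * m); last by ring.
  by apply: ler_wpM2l => //; do 3 ?[apply: mulr_ge0 => //].
have t3 := ler_wpM2r u_ge0 absorb.
have S_ge : u ^+ 2 <= B + E * b ^+ 2 * p + E * (N * (2 * u ^+ 2)) * p.
  by move: t3 B_ge; rewrite mulrDl mul1r mulNr; lra.
rewrite (le_trans S_ge)// ler_peMl//; first exact: le_trans S_ge.
by rewrite -expR0 ler_expR.
Qed.

End OneVariable.

(** * Strong convexity *)

Theorem theorem4 (R : realType) (n : nat) (X : set 'rV[R]_n)
    (Xclosed : closed X) (Xconvex : convex_set X)
    (f : mpoly.mpoly n R) (m : R) (m_gt0 : 0 < m)
    (f_ge : forall x : 'rV[R]_n, X x -> m <= peval f x) :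
  exists N0 : R, forall N : R, N0 <= N -> strongly_convex X (Phi f N).
Proof.
have [h h_bound] := mdirderiv_bound f.
pose Q : mpoly n R := m^-1 *: h ^+ 2 + h + 1.
have [C [k [C_ge0 k_ge0 Q_growth]]] := peval_exp_growth Q.
(* The sum is at least both thresholds: k for the exponent, C / (2 m) for the
   coefficient. *)
exists (k + C / (2 * m)) => N N_ge.
have C2m_ge0 : 0 <= C / (2 * m) by rewrite divr_ge0// mulr_ge0// ltW.
have kN : k <= N by lra.
have N_ge0 : 0 <= N by lra.
have CN : C <= 2 * m * N by rewrite mulrC -ler_pdivrMr; [lra|rewrite mulr_gt0].
have absorb z : peval h z ^+ 2 / m + peval h z + 1
    <= 2 * m * N * expR (N * enorm z ^+ 2).
  have -> : peval h z ^+ 2 / m + peval h z + 1 = peval Q z.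
    by rewrite !pevalE [_ / m]mulrC.
  apply: le_trans (ler_norm _) _; apply: le_trans (Q_growth z) _.
  by rewrite ler_pM// ?expR_ge0// ler_expR ler_wpM2r// sqr_ge0.
exists 1 => // t x y xX yX.
pose v := y - x.
have convE (a b : 'rV[R]_n) (l : R) : l *: b + (1 - l) *: a = a + l *: (b - a).
  by rewrite scalerBl scale1r scalerBr addrCA.
have segment_mem (s : R) : 0 <= s <= 1 -> X (x + s *: v).
  move=> /andP[s0 s1].
  have := Xconvex y x (Itv01 s0 s1) yX xX.
  by rewrite inE /conv/= convE.
have -> : conv t x y = x + (1 - t%:num) *: v.
  by rewrite -convE subKr addrC.
pose line (p : mpoly n R) (s : R) := peval p (x + s *: v).
have dline p (s : R) : is_derive s 1 (line p) (line (mdirderiv v p) s).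
  exact: is_derive_peval_line.
pose r := sqnorm_poly : mpoly n R.
have := second_derive_ge_conv01 (c := 1 / 2)
  (fun s => is_derive_expexpM N (dline f s) (dline r s))
  (fun s => is_derive_expexpM1 N (dline f s) (dline (mdirderiv v f) s)
     (dline r s) (dline (mdirderiv v r) s))
  (dline r) (dline (mdirderiv v r)) _ t.
rewrite /line !peval_sqnorm_poly scale0r addr0 scale1r /v subrKC; apply.
move=> s /andP[s0 s1].
have Xz : X (x + s *: v) by apply: segment_mem; rewrite !ltW.
(* mu / 2 times the second derivative 2 |v|^2 of the squared norm is |v|^2. *)
rewrite mdirderiv2_sqnorm_poly pevalC mulrA divfK// mul1r.
have [_ b1 b2] := h_bound (x + s *: v) v.
apply: (expexpM2_ge _ N_ge0 m_gt0 (f_ge _ Xz) b1 b2).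
by rewrite peval_sqnorm_poly.
Qed.
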